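(* Let $(B_{n,p})_{n,p\ge 0}$ be the $p$-Bernoulli numbers, i.e. the unique family of numbers such that $B_{n,0}=B_n$ is the classical Bernoulli number for every $n\ge 0$ (so that $\sum_{n\ge0}B_n\frac{t^n}{n!}=\frac{t}{e^t-1}$), and \[ B_{n+1,p}=pB_{n,p}-\frac{(p+1)^2}{p+2}B_{n,p+1}\qquad\text{for all } n,p\ge 0 . \] Then for every integer $p\ge 0$, \[ \sum_{n=0}^{\infty}B_{n,p}\frac{t^n}{n!}=\frac{(p+1)(t-H_p)e^{pt}}{(e^t-1)^{p+1}}+(p+1)\sum_{k=1}^{p}\binom{p}{k}\frac{H_k}{(e^t-1)^{k+1}}, \] where $H_n=\sum_{j=1}^{n}\frac1j$ denotes the $n$-th harmonic number (with $H_0=0$).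
   Context: The recursion determines $B_{n,p+1}$ uniquely from $B_{n,p}$ and $B_{n+1,p}$ (namely $B_{n,p+1}=\frac{p+2}{(p+1)^2}\bigl(pB_{n,p}-B_{n+1,p}\bigr)$), so the family is well defined from the classical Bernoulli numbers $B_{n,0}=B_n$ (with $B_1=-\tfrac12$). The identity is an identity of exponential generating functions: the right-hand side has a removable singularity at $t=0$ and the left-hand side is its Taylor expansion about $t=0$ (equivalently, an identity of formal power series in $t$). *)

(* Defs.v *)
From Stdlib Require Import Reals Lra Lia Arith.
From Coquelicot Require Import Coquelicot.
Open Scope R_scope.

(* Below, [C] is Coquelicot's type of complex numbers; the binomial coefficient
   of the standard library is always written [Binomial.C]. *)

(* [bernoulli_upto n] tabulates B_0, ..., B_n (its values beyond n are
   irrelevant). *)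
Fixpoint bernoulli_upto (n : nat) : nat -> R :=
  match n with
  | O => fun _ => 1
  | S m => fun k =>
      if (k <=? m)%nat then bernoulli_upto m k
      else - / INR (S (S m)) *
           sum_f_R0 (fun j => Binomial.C (S (S m)) j * bernoulli_upto m j) m
  end.

(* Classical Bernoulli numbers, with B_1 = -1/2: they are determined by
   [bernoulli_0] and [bernoulli_sum] below. *)
Definition bernoulli (n : nat) : R := bernoulli_upto n n.

Lemma bernoulli_upto_stable (n k : nat) :
  (k <= n)%nat -> bernoulli_upto n k = bernoulli k.
Proof.
induction n as [|n IH]; intros Hk.
- now replace k with 0%nat by lia.
- destruct (Nat.eq_dec k (S n)) as [->|Hne]; [reflexivity|].
  simpl. destruct (Nat.leb_spec k n) as [H|H]; [now apply IH | lia].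
Qed.

Lemma bernoulli_0 : bernoulli 0 = 1.
Proof. reflexivity. Qed.

Lemma bernoulli_sum (n : nat) :
  (1 <= n)%nat ->
  sum_f_R0 (fun k => Binomial.C (S n) k * bernoulli k) n = 0.
Proof.
destruct n as [|m]; [lia|intros _].
assert (Hb : bernoulli (S m) = - / INR (S (S m)) *
  sum_f_R0 (fun j => Binomial.C (S (S m)) j * bernoulli j) m).
{ unfold bernoulli at 1. cbn [bernoulli_upto].
  destruct (Nat.leb_spec (S m) m) as [H|H]; [lia|].
  f_equal. apply sum_eq. intros i Hi. now rewrite bernoulli_upto_stable. }
rewrite tech5, Hb.
assert (HC : Binomial.C (S (S m)) (S m) = INR (S (S m))).
{ unfold Binomial.C. replace (S (S m) - S m)%nat with 1%nat by lia.
  rewrite (fact_simpl (S m)), mult_INR. simpl (fact 1). simpl (INR 1).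
  field. apply INR_fact_neq_0. }
rewrite HC. field. apply not_0_INR; lia.
Qed.

Lemma bernoulli_1 : bernoulli 1 = - / 2.
Proof. unfold bernoulli. simpl. unfold Binomial.C. simpl. field. Qed.

(* B n p is the p-Bernoulli number B_{n,p}. *)
Definition is_pBernoulli (B : nat -> nat -> R) : Prop :=
  (forall n : nat, B n 0%nat = bernoulli n) /\
  (forall n p : nat,
     B (S n) p = INR p * B n p
                 - (INR p + 1) ^ 2 / (INR p + 2) * B n (S p)).

Lemma pBernoulli_exists : exists B, is_pBernoulli B.
Proof.
exists (fun n p =>
  (fix F (p n : nat) {struct p} : R :=
     match p with
     | O => bernoulli n
     | S q => (INR q + 2) / (INR q + 1) ^ 2 * (INR q * F q n - F q (S n))
     end) p n).
split; [reflexivity|]. intros n p. cbv beta.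
pose proof (pos_INR p). cbn -[INR pow]. field. lra.
Qed.

Lemma pBernoulli_unique (B B' : nat -> nat -> R) :
  is_pBernoulli B -> is_pBernoulli B' -> forall n p : nat, B n p = B' n p.
Proof.
intros [B0 BS] [B0' BS'] n p. revert n.
induction p as [|p IH]; intros n.
- now rewrite B0, B0'.
- pose proof (pos_INR p) as Hp.
  pose proof (BS n p) as E. pose proof (BS' n p) as E'.
  rewrite (IH n), (IH (S n)) in E. rewrite E' in E.
  apply (Rmult_eq_reg_l ((INR p + 1) ^ 2 / (INR p + 2))); [lra|].
  apply Rgt_not_eq, Rdiv_lt_0_compat; [apply pow_lt|]; lra.
Qed.

Definition harmonic (n : nat) : R := sum_n_m (fun j => / INR j) 1 n.

Definition Cexp (z : C) : C := (exp (Re z) * cos (Im z), exp (Re z) * sin (Im z)).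

(* Main.v *)
Require Import Defs.
From Stdlib Require Import Reals Arith Lra Lia FunctionalExtensionality.
From Coquelicot Require Import Coquelicot.
Open Scope R_scope.

(* Let T, E, U be the power series of t, e^t, e^t - 1 and F_p that of
   (B_{n,p} / n!)_n.  The recursion says F_{p+1} = (p+2)/(p+1)^2 (p F_p - F_p').
   Multiplying by U^{p+1} to avoid division, one shows by induction that
     F_p U^{p+1} = (p+1) ((T - H_p) E^p + S_p)
   in the ring of formal power series, where S_0 = 0 and
     S_{p+1} = E S_p + (E^{p+1} - U^{p+1}) / (p+1);
   the induction rests on S_p' = p S_p - E^p + U^p.  All series involved converge
   absolutely near 0, so the identity can be evaluated at t; there U is
   nonzero for t <> 0, since F_0 U = T, and S_p / U^{p+1} becomes
   the sum of C(p,k) H_k / u^{k+1} with u = e^t - 1. *)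

(** * The commutative ring of formal power series over the complex numbers *)

Section FormalPowerSeries.
Local Open Scope C_scope.

(** Functional extensionality makes equality of series Leibniz equality, so that [rewrite] and
    [ring] apply without setoids. *)
Definition fps := nat -> C.

Definition fadd (a b : fps) : fps := fun n => a n + b n.
Definition fopp (a : fps) : fps := fun n => - a n.
Definition fsub (a b : fps) : fps := fadd a (fopp b).
Definition fcst (c : C) : fps := fun n => match n with O => c | _ => 0 end.
Definition fX : fps := fun n => match n with 1%nat => 1 | _ => 0 end.
Definition fshift (a : fps) : fps := fun n => a (S n).
Definition fderiv (a : fps) : fps := fun n => INR (S n) * a (S n).

(* The Cauchy product, by recursion on a = a_0 + X * fshift a. *)
Fixpoint cauchy_coef (a b : fps) (n : nat) : C :=
  match n with
  | O => a O * b O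
  | S m => a O * b (S m) + cauchy_coef (fshift a) b m
  end.

Definition fmul (a b : fps) : fps := cauchy_coef a b.

Lemma fmul_O (a b : fps) : fmul a b O = a O * b O.
Proof. reflexivity. Qed.

Lemma fmul_S (a b : fps) (n : nat) :
  fmul a b (S n) = a O * b (S n) + fmul (fshift a) b n.
Proof. reflexivity. Qed.

Fixpoint fpow (a : fps) (n : nat) : fps :=
  match n with O => fcst 1 | S m => fmul a (fpow a m) end.

Lemma fmul_addl (a b c : fps) : fmul (fadd a b) c = fadd (fmul a c) (fmul b c).
Proof.
apply functional_extensionality; intros n; revert a b.
induction n as [|n IH]; intros a b; unfold fadd in *;
  rewrite ?fmul_O, ?fmul_S; [ring|].
change (fshift (fun n => a n + b n)) with (fun n => fshift a n + fshift b n).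
rewrite IH; ring.
Qed.

Lemma fmul_0l (b : fps) : fmul (fcst 0) b = fcst 0.
Proof.
apply functional_extensionality; intros n.
(* The constant function 0 is its own shift by conversion, unlike [fcst 0], so the induction runs on
   it. *)
assert (H : forall n, fmul (fun _ => 0) b n = 0).
{ clear n; induction n as [|n IH]; rewrite ?fmul_O, ?fmul_S; [ring|].
  change (fshift (fun _ => 0)) with (fun _ : nat => RtoC 0); rewrite IH; ring. }
replace (fcst 0) with (fun _ : nat => RtoC 0); [apply H|].
apply functional_extensionality; now intros [|m].
Qed.

Lemma fmul_cst (c : C) (b : fps) : fmul (fcst c) b = fun n => c * b n.
Proof.
apply functional_extensionality; intros [|n]; [reflexivity|].
rewrite fmul_S; replace (fshift (fcst c)) with (fcst 0)
  by (apply functional_extensionality; now intros [|m]).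
rewrite fmul_0l; destruct n; simpl; ring.
Qed.

Lemma fmul_scal (c : C) (a b : fps) (n : nat) :
  fmul (fun k => c * a k) b n = c * fmul a b n.
Proof.
revert a; induction n as [|n IH]; intros a; rewrite ?fmul_O, ?fmul_S; [ring|].
change (fshift (fun k => c * a k)) with (fun k => c * fshift a k).
rewrite IH; ring.
Qed.

Lemma fshift_mul (a b : fps) :
  fshift (fmul a b) = fadd (fun n => a O * fshift b n) (fmul (fshift a) b).
Proof. reflexivity. Qed.

Lemma fmul_assoc (a b c : fps) : fmul a (fmul b c) = fmul (fmul a b) c.
Proof.
apply functional_extensionality; intros n; revert a b.
induction n as [|n IH]; intros a b; [rewrite !fmul_O; ring|].
rewrite !fmul_S, fshift_mul, fmul_addl; unfold fadd.
rewrite <- IH, fmul_scal, fmul_O; unfold fshift; ring.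
Qed.

(** Mirror image of [fmul_S], splitting off the constant term of the right factor; comparing the two
    recursions gives commutativity. *)
Lemma fmul_S_last (a b : fps) (n : nat) :
  fmul a b (S n) = a (S n) * b O + fmul a (fshift b) n.
Proof.
revert a; induction n as [|n IH]; intros a;
  [rewrite fmul_S, !fmul_O; unfold fshift; ring|].
rewrite (fmul_S a b), IH, fmul_S; unfold fshift; ring.
Qed.

Lemma fmul_comm (a b : fps) : fmul a b = fmul b a.
Proof.
apply functional_extensionality; intros n; revert a b.
induction n as [|n IH]; intros a b; [rewrite !fmul_O; ring|].
rewrite fmul_S_last, fmul_S, IH; ring.
Qed.

Lemma fps_ring : ring_theory (fcst 0) (fcst 1) fadd fmul fsub fopp eq.
Proof.
split; intros; try apply fmul_comm; try apply fmul_assoc; try apply fmul_addl;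
  try (rewrite fmul_cst);
  apply functional_extensionality; intros n; unfold fsub, fadd, fopp; try ring;
  destruct n; simpl; ring.
Qed.

End FormalPowerSeries.

Add Ring fps_ring : fps_ring.

(** * Derivation, exponential series, and the induction step with denominators cleared *)

Section ClearedDenominators.
Local Open Scope C_scope.

(** The operator [theta] = X d/dX multiplies coefficient n by n without moving it, so its Leibniz
    rule follows by induction along [fmul_S]. Reading that rule at index n + 1 gives the rule for
    [fderiv]. *)
Lemma fderiv_mul (a b : fps) :
  fderiv (fmul a b) = fadd (fmul (fderiv a) b) (fmul a (fderiv b)).
Proof.
set (theta := fun (a : fps) n => INR n * a n).
assert (H : forall n a b,
  INR n * fmul a b n = fmul (theta a) b n + fmul a (theta b) n).
{ clear; induction n as [|n IH]; intros a b; [rewrite !fmul_O; unfold theta; simpl; ring|].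
  rewrite !fmul_S.
  replace (fshift (theta a)) with (fadd (theta (fshift a)) (fshift a))
    by (apply functional_extensionality; intros k;
        unfold fadd, theta, fshift; rewrite S_INR, RtoC_plus; ring).
  rewrite fmul_addl; unfold fadd.
  rewrite S_INR, RtoC_plus.
  transitivity ((INR n + 1) * (a O * b (S n)) + INR n * fmul (fshift a) b n
    + fmul (fshift a) b n); [ring|].
  rewrite IH; unfold theta; rewrite S_INR, RtoC_plus; simpl (INR 0); ring. }
apply functional_extensionality; intros n.
change (INR (S n) * fmul a b (S n) =
        fadd (fmul (fderiv a) b) (fmul a (fderiv b)) n).
rewrite H, (fmul_S_last a (theta b)); unfold fadd; rewrite fmul_S.
change (fshift (theta a)) with (fderiv a).
change (fshift (theta b)) with (fderiv b).
unfold theta; simpl (INR 0); ring.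
Qed.

Lemma fderiv_add (a b : fps) : fderiv (fadd a b) = fadd (fderiv a) (fderiv b).
Proof. apply functional_extensionality; intros n; unfold fderiv, fadd; ring. Qed.

Lemma fderiv_opp (a : fps) : fderiv (fopp a) = fopp (fderiv a).
Proof. apply functional_extensionality; intros n; unfold fderiv, fopp; ring. Qed.

Lemma fderiv_cst (c : C) : fderiv (fcst c) = fcst 0.
Proof.
apply functional_extensionality; intros [|n]; unfold fderiv; cbn -[INR]; ring.
Qed.

Lemma fderiv_X : fderiv fX = fcst 1.
Proof.
apply functional_extensionality; intros [|n]; unfold fderiv; cbn -[INR];
  simpl (INR 1); ring.
Qed.

Lemma fcst_add (c d : C) : fcst (c + d) = fadd (fcst c) (fcst d).
Proof. apply functional_extensionality; intros [|n]; unfold fadd; simpl; ring. Qed.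

Lemma fcst_mul (c d : C) : fcst (c * d) = fmul (fcst c) (fcst d).
Proof.
rewrite fmul_cst; apply functional_extensionality; intros [|n]; simpl; ring.
Qed.

Lemma fderiv_pow (a : fps) (n : nat) :
  fderiv (fpow a (S n)) = fmul (fcst (INR (S n))) (fmul (fpow a n) (fderiv a)).
Proof.
induction n as [|n IH].
- simpl; rewrite fderiv_mul, fderiv_cst; ring.
- change (fpow a (S (S n))) with (fmul a (fpow a (S n))).
  rewrite fderiv_mul, IH, (S_INR (S n)), RtoC_plus, fcst_add; cbn [fpow]; ring.
Qed.

Lemma RtoC_INR_S_neq_0 (n : nat) : RtoC (INR (S n)) <> 0.
Proof. intros K; apply RtoC_inj in K; revert K; apply not_0_INR; lia. Qed.

Lemma RtoC_INR_fact_neq_0 (n : nat) : RtoC (INR (fact n)) <> 0.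
Proof. intros K; apply RtoC_inj in K; revert K; apply INR_fact_neq_0. Qed.

(** The equation f' = c f determines each coefficient from the previous one, as n + 1 is invertible
    in C. *)
Lemma fderiv_exp_unique (c : C) (a b : fps) :
  fderiv a = fmul (fcst c) a -> fderiv b = fmul (fcst c) b -> a O = b O -> a = b.
Proof.
intros Ha Hb H0; rewrite fmul_cst in Ha, Hb.
apply functional_extensionality; intros n; induction n as [|n IH]; [exact H0|].
apply (f_equal (fun f => f n)) in Ha; apply (f_equal (fun f => f n)) in Hb.
unfold fderiv in Ha, Hb.
pose proof (RtoC_INR_S_neq_0 n) as Hn.
apply (f_equal (fun z => / RtoC (INR (S n)) * z)) in Ha, Hb.
rewrite Cmult_assoc, Cinv_l, Cmult_1_l in Ha, Hb by exact Hn.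
now rewrite Ha, Hb, IH.
Qed.

(** The series of e^(zX). Its coefficients are also the terms of the numerical series for e^z, which
    is how [abs_sum_fexp] reads them. *)
Definition fexp (z : C) : fps := fun n => z ^ n / INR (fact n).

Lemma fderiv_exp (z : C) : fderiv (fexp z) = fmul (fcst z) (fexp z).
Proof.
rewrite fmul_cst; apply functional_extensionality; intros n.
unfold fderiv, fexp; rewrite fact_simpl, mult_INR, RtoC_mult; simpl (z ^ S n).
field; auto using RtoC_INR_S_neq_0, RtoC_INR_fact_neq_0.
Qed.

(** Both sides solve f' = (z + w) f with constant term 1, which replaces a computation with the
    binomial theorem. *)
Lemma fexp_add (z w : C) : fmul (fexp z) (fexp w) = fexp (z + w).
Proof.
apply (fderiv_exp_unique (z + w)).
- rewrite fderiv_mul, !fderiv_exp, fcst_add; ring.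
- apply fderiv_exp.
- rewrite fmul_O; unfold fexp; simpl; field.
Qed.

Definition fE : fps := fexp 1.
Definition fU : fps := fsub fE (fcst 1).

Lemma fE_U : fE = fadd fU (fcst 1).
Proof. unfold fU; ring. Qed.

Lemma fderiv_E : fderiv fE = fE.
Proof. unfold fE; rewrite fderiv_exp; ring. Qed.

Lemma fderiv_U : fderiv fU = fE.
Proof.
unfold fU, fsub; rewrite fderiv_add, fderiv_opp, fderiv_cst, fderiv_E; ring.
Qed.

Lemma fderiv_Epow (n : nat) : fderiv (fpow fE n) = fmul (fcst (INR n)) (fpow fE n).
Proof.
destruct n as [|n]; [simpl; rewrite fderiv_cst; ring|].
rewrite fderiv_pow, fderiv_E; simpl; ring.
Qed.

(* [fS p] is the sum of C(p,k) H_k U^(p-k) over 1 <= k <= p: see [fev_S]. *)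
Fixpoint fS (p : nat) : fps :=
  match p with
  | O => fcst 0
  | S q => fadd (fmul fE (fS q))
             (fmul (fcst (/ INR (S q))) (fsub (fpow fE (S q)) (fpow fU (S q))))
  end.

Lemma fcst_inv (n : nat) :
  fmul (fcst (INR (S n))) (fcst (/ INR (S n))) = fcst 1.
Proof. rewrite <- fcst_mul; f_equal; field; apply RtoC_INR_S_neq_0. Qed.

(** In the induction, the derivative of the correction term of [fS] is E (E^p - U^p); it cancels the
    E (U^p - E^p) supplied by the induction hypothesis. *)
Lemma fderiv_S (p : nat) :
  fderiv (fS p) =
  fadd (fmul (fcst (INR p)) (fS p)) (fsub (fpow fU p) (fpow fE p)).
Proof.
induction p as [|p IH]; [simpl; rewrite fderiv_cst; ring|].
cbn [fS].
unfold fsub at 1; rewrite fderiv_add, !fderiv_mul, fderiv_add, fderiv_opp.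
rewrite fderiv_cst, fderiv_Epow, fderiv_pow, fderiv_U, fderiv_E, IH.
pose proof (fcst_inv p) as Hi.
(* With p written as c - 1, the only relation left between constants is c i = 1, which [ring [Hi]]
   can use. *)
assert (HS : fcst (INR p) = fsub (fcst (INR (S p))) (fcst 1))
  by (rewrite S_INR, RtoC_plus, fcst_add; ring).
rewrite HS; revert Hi.
generalize (fcst (INR (S p))) (fcst (/ INR (S p))); intros c i Hi.
cbn [fpow]; rewrite fE_U; ring [Hi].
Qed.

Lemma harmonic_S (p : nat) : harmonic (S p) = (harmonic p + / INR (S p))%R.
Proof. unfold harmonic; rewrite sum_n_Sm by lia; reflexivity. Qed.

Definition fnum (p : nat) : fps :=
  fmul (fcst (INR (S p)))
    (fadd (fmul (fsub fX (fcst (harmonic p))) (fpow fE p)) (fS p)).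

(* Only the product rule is used, so no division by the (non-invertible) series
   [fU] is needed. *)
Lemma fps_step (p : nat) (a a' : fps) :
  fmul (fcst (INR (S p) * INR (S p))) a' =
    fmul (fcst (INR (S (S p)))) (fsub (fmul (fcst (INR p)) a) (fderiv a)) ->
  fmul a (fpow fU (S p)) = fnum p ->
  fmul a' (fpow fU (S (S p))) = fnum (S p).
Proof.
intros Ha' Ha.
pose proof (f_equal fderiv Ha) as Hd.
rewrite fderiv_mul, fderiv_pow, fderiv_U in Hd.
unfold fnum, fsub in Hd.
rewrite !fderiv_mul, !fderiv_add, fderiv_mul, fderiv_add, fderiv_opp, !fderiv_cst,
  fderiv_X, fderiv_Epow, fderiv_S in Hd.
unfold fnum in Ha |- *.
cbn [fS]; rewrite harmonic_S, RtoC_plus, fcst_add.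
pose proof (fcst_inv p) as Hi.
rewrite RtoC_inv by (apply not_0_INR; lia).
assert (HS : fcst (INR p) = fsub (fcst (INR (S p))) (fcst 1))
  by (rewrite S_INR, RtoC_plus, fcst_add; ring).
assert (HSS : fcst (INR (S (S p))) = fadd (fcst (INR (S p))) (fcst 1))
  by (rewrite (S_INR (S p)), RtoC_plus, fcst_add; ring).
rewrite fcst_mul in Ha'.
rewrite HSS, HS in *; clear HS HSS.
revert Hi Ha Hd Ha'.
generalize (fcst (INR (S p))) (fcst (/ INR (S p))) (fS p) (fcst (harmonic p)).
intros c i s h Hi Ha Hd Ha'.
cbn [fpow] in *; rewrite fE_U in *; revert Ha Hd Ha'.
generalize (fpow (fadd fU (fcst 1)) p) (fpow fU p); intros e u.
generalize fU fX (fderiv a); intros U X da Ha Hd Ha'.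
(* Since c i = 1, inserting i^2 c^2 produces the factor c^2 a' that the recursion rewrites. *)
transitivity (fmul (fmul i i) (fmul (fmul (fmul c c) a') (fmul U (fmul U u))));
  [ring [Hi]|].
rewrite Ha'.
(* With N = a U^(p+1), the right-hand side is regrouped as i^2 (c+1) (p U N - U N' + c E N), so that
   [a] and its derivative occur only inside N and N'. *)
transitivity (fmul (fmul (fmul i i) (fadd c (fcst 1)))
  (fadd (fsub (fmul (fmul (fsub c (fcst 1)) U) (fmul a (fmul U u)))
     (fmul U (fadd (fmul da (fmul U u)) (fmul a (fmul c (fmul u (fadd U (fcst 1))))))))
     (fmul (fmul c (fadd U (fcst 1))) (fmul a (fmul U u))))); [ring|].
rewrite Hd, Ha.
(* By the formula for S_p', p N - N' collapses to -(p+1) U^p. The passage from H_p to H_(p+1)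
   contributes -E^(p+1)/(p+1), which cancels the E^(p+1)/(p+1) in [fS (S p)]. *)
ring [Hi].
Qed.

End ClearedDenominators.

(** * Evaluation of absolutely convergent series at a complex point *)

Section Evaluation.
Local Open Scope C_scope.

(** Sums are taken componentwise so that theorems on real series apply; the clause on moduli makes
    the notion stable under Cauchy products. *)
Definition abs_sum (c : nat -> C) (v : C) : Prop :=
  is_series (fun n => Re (c n)) (Re v) /\
  is_series (fun n => Im (c n)) (Im v) /\
  ex_series (fun n => Cmod (c n)).

Lemma abs_sum_unique (c : nat -> C) (v w : C) :
  abs_sum c v -> abs_sum c w -> v = w.
Proof.
intros (Hv1 & Hv2 & _) (Hw1 & Hw2 & _); apply injective_projections.
- change (Re v = Re w).
  now rewrite <- (is_series_unique _ _ Hv1), <- (is_series_unique _ _ Hw1).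
- change (Im v = Im w).
  now rewrite <- (is_series_unique _ _ Hv2), <- (is_series_unique _ _ Hw2).
Qed.

Lemma Rabs_Re_le (z : C) : (Rabs (Re z) <= Cmod z)%R.
Proof. eapply Rle_trans; [apply Rmax_l | apply Rmax_Cmod]. Qed.

Lemma Rabs_Im_le (z : C) : (Rabs (Im z) <= Cmod z)%R.
Proof. eapply Rle_trans; [apply Rmax_r | apply Rmax_Cmod]. Qed.

Lemma ex_series_Re_Im (c : nat -> C) :
  ex_series (fun n => Cmod (c n)) ->
  ex_series (fun n => Rabs (Re (c n))) /\ ex_series (fun n => Rabs (Im (c n))).
Proof.
intros H; split; refine (ex_series_le _ _ _ H); intros n;
  change norm with Rabs; simpl; rewrite Rabs_Rabsolu.
- apply Rabs_Re_le.
- apply Rabs_Im_le.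
Qed.

Lemma abs_sum_exists (c : nat -> C) :
  ex_series (fun n => Cmod (c n)) -> exists v, abs_sum c v.
Proof.
intros H; destruct (ex_series_Re_Im c H) as [H1 H2].
destruct (ex_series_Rabs _ H1) as [x Hx], (ex_series_Rabs _ H2) as [y Hy].
now exists (x, y).
Qed.

Lemma abs_sum_plus (a b : nat -> C) (v w : C) :
  abs_sum a v -> abs_sum b w -> abs_sum (fun n => a n + b n) (v + w).
Proof.
intros (Hv1 & Hv2 & Hv3) (Hw1 & Hw2 & Hw3); split; [|split].
- exact (is_series_plus _ _ _ _ Hv1 Hw1).
- exact (is_series_plus _ _ _ _ Hv2 Hw2).
- refine (ex_series_le _ _ _ (ex_series_plus _ _ Hv3 Hw3)); intros n.
  change norm with Rabs; simpl; rewrite Rabs_pos_eq by apply Cmod_ge_0.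
  apply Cmod_triangle.
Qed.

Lemma abs_sum_finite (c : nat -> C) (N : nat) :
  (forall n, (N < n)%nat -> c n = 0) ->
  abs_sum c (sum_f_R0 (fun n => Re (c n)) N, sum_f_R0 (fun n => Im (c n)) N).
Proof.
intros Hc.
assert (H : forall f : nat -> R, (forall n, (N < n)%nat -> f n = 0%R) ->
  is_series f (sum_f_R0 f N)).
{ intros f Hf; apply is_series_Reals; intros eps Heps; exists N; intros n Hn.
  replace (sum_f_R0 f n) with (sum_f_R0 f N); [now rewrite Rdist_eq|].
  induction Hn as [|n Hn IH]; [reflexivity|].
  simpl; rewrite <- IH, Hf by lia; ring. }
split; [|split].
- apply H; intros n Hn; now rewrite Hc.
- apply H; intros n Hn; now rewrite Hc.
- eexists; apply H; intros n Hn; rewrite Hc by easy; apply Cmod_0.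
Qed.

Lemma sum_f_R0_first (f : nat -> R) (n : nat) :
  sum_f_R0 f (S n) = (f O + sum_f_R0 (fun k => f (S k)) n)%R.
Proof. now rewrite decomp_sum by lia. Qed.

Lemma fmul_sum (a b : nat -> C) (n : nat) :
  fmul a b n = (sum_f_R0 (fun k => Re (a k * b (n - k)%nat)) n,
                sum_f_R0 (fun k => Im (a k * b (n - k)%nat)) n).
Proof.
revert a; induction n as [|n IH]; intros a; [reflexivity|].
rewrite fmul_S, !sum_f_R0_first, IH; reflexivity.
Qed.

Lemma Cmod_fmul_le (a b : nat -> C) (n : nat) :
  (Cmod (fmul a b n) <= sum_f_R0 (fun k => Cmod (a k) * Cmod (b (n - k)%nat)) n)%R.
Proof.
revert a; induction n as [|n IH]; intros a.
- rewrite fmul_O, Cmod_mult; simpl; apply Rle_refl.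
- rewrite fmul_S, sum_f_R0_first.
  eapply Rle_trans; [apply Cmod_triangle|]; rewrite Cmod_mult.
  apply Rplus_le_compat_l, IH.
Qed.

(** The real part of the product is a difference, and the imaginary part a sum, of two real Cauchy
    products. The moduli are dominated by the Cauchy product of the moduli. *)
Lemma abs_sum_mul (a b : nat -> C) (v w : C) :
  abs_sum a v -> abs_sum b w -> abs_sum (fmul a b) (v * w).
Proof.
intros (Hv1 & Hv2 & Hv3) (Hw1 & Hw2 & Hw3).
destruct (ex_series_Re_Im a Hv3) as [Ha1 Ha2], (ex_series_Re_Im b Hw3) as [Hb1 Hb2].
split; [|split].
- eapply is_series_ext;
    [|exact (is_series_minus _ _ _ _ (is_series_mult _ _ _ _ Hv1 Hw1 Ha1 Hb1)
                                     (is_series_mult _ _ _ _ Hv2 Hw2 Ha2 Hb2))].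
  intros n; rewrite fmul_sum; symmetry.
  exact (minus_sum (fun k => Re (a k) * Re (b (n - k)%nat))%R
                   (fun k => Im (a k) * Im (b (n - k)%nat))%R n).
- eapply is_series_ext;
    [|exact (is_series_plus _ _ _ _ (is_series_mult _ _ _ _ Hv1 Hw2 Ha1 Hb2)
                                    (is_series_mult _ _ _ _ Hv2 Hw1 Ha2 Hb1))].
  intros n; rewrite fmul_sum; symmetry.
  exact (plus_sum (fun k => Re (a k) * Im (b (n - k)%nat))%R
                  (fun k => Im (a k) * Re (b (n - k)%nat))%R n).
- assert (Hpos : forall c : nat -> C, ex_series (fun n => Cmod (c n)) ->
    ex_series (fun n => Rabs (Cmod (c n)))).
  { intros c; apply ex_series_ext; intros n; symmetry.
    apply Rabs_pos_eq, Cmod_ge_0. }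
  pose proof (Hpos a Hv3) as Ha; pose proof (Hpos b Hw3) as Hb.
  destruct Hv3 as [x Hx], Hw3 as [y Hy].
  refine (ex_series_le _ _ _ (ex_intro _ _ (is_series_mult _ _ _ _ Hx Hy Ha Hb))).
  intros n; change norm with Rabs; simpl.
  rewrite Rabs_pos_eq by apply Cmod_ge_0; apply Cmod_fmul_le.
Qed.

Lemma abs_sum_ext (a b : nat -> C) (v : C) :
  (forall n, a n = b n) -> abs_sum a v -> abs_sum b v.
Proof. intros H; now replace b with a by now apply functional_extensionality. Qed.

Definition fev (a : fps) (t v : C) : Prop := abs_sum (fun n => a n * t ^ n) v.

Lemma fev_unique (a : fps) (t v w : C) : fev a t v -> fev a t w -> v = w.
Proof. apply abs_sum_unique. Qed.

Lemma fev_add (a b : fps) (t v w : C) :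
  fev a t v -> fev b t w -> fev (fadd a b) t (v + w).
Proof.
intros Ha Hb; eapply abs_sum_ext; [|exact (abs_sum_plus _ _ _ _ Ha Hb)].
intros n; unfold fadd; simpl; ring.
Qed.

(** Weighting coefficient n by t^n is compatible with the Cauchy product, which reduces the claim to
    [abs_sum_mul]. *)
Lemma fev_mul (a b : fps) (t v w : C) :
  fev a t v -> fev b t w -> fev (fmul a b) t (v * w).
Proof.
intros Ha Hb; eapply abs_sum_ext; [|exact (abs_sum_mul _ _ _ _ Ha Hb)].
clear; intros n; revert a; induction n as [|n IH]; intros a.
- rewrite !fmul_O; simpl; ring.
- rewrite !fmul_S.
  replace (fshift (fun k => a k * t ^ k)) with (fun k => t * (fshift a k * t ^ k))
    by (apply functional_extensionality; intros k; unfold fshift; simpl; ring).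
  rewrite fmul_scal, IH; simpl; ring.
Qed.

Lemma fev_cst (c t : C) : fev (fcst c) t c.
Proof.
replace c with
  (sum_f_R0 (fun n => Re (fcst c n * t ^ n)) 0, sum_f_R0 (fun n => Im (fcst c n * t ^ n)) 0)
  at 2.
- apply abs_sum_finite; intros [|n] Hn; [lia|simpl; ring].
- simpl; apply injective_projections; simpl; ring.
Qed.

Lemma fev_X (t : C) : fev fX t t.
Proof.
replace t with
  (sum_f_R0 (fun n => Re (fX n * t ^ n)) 1, sum_f_R0 (fun n => Im (fX n * t ^ n)) 1)
  at 2.
- apply abs_sum_finite; intros [|[|n]] Hn; [lia|lia|simpl; ring].
- simpl; apply injective_projections; simpl; ring.
Qed.

Lemma fev_opp (a : fps) (t v : C) : fev a t v -> fev (fopp a) t (- v).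
Proof.
intros Ha; replace (- v) with (RtoC (-1) * v) by ring.
eapply abs_sum_ext; [|exact (fev_mul _ _ _ _ _ (fev_cst (-1) t) Ha)].
intros n; simpl; rewrite fmul_cst; unfold fopp; ring.
Qed.

Lemma fev_sub (a b : fps) (t v w : C) :
  fev a t v -> fev b t w -> fev (fsub a b) t (v - w).
Proof. intros Ha Hb; apply fev_add; [exact Ha|now apply fev_opp]. Qed.

Lemma fev_pow (a : fps) (t v : C) (n : nat) :
  fev a t v -> fev (fpow a n) t (v ^ n).
Proof.
intros Ha; induction n as [|n IH]; [apply fev_cst|now apply fev_mul].
Qed.

(** * The exponential series and its value [Cexp] *)

Lemma ex_series_fexp (z : C) : ex_series (fun n => Cmod (fexp z n)).
Proof.
exists (exp (Cmod z)).
eapply is_series_ext; [|exact (proj1 (is_pseries_R _ _ _) (is_exp_Reals (Cmod z)))].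
intros n; simpl; unfold fexp.
rewrite Cmod_div, Cmod_pow, Cmod_R, Rabs_pos_eq by
  (try apply RtoC_INR_fact_neq_0; apply pos_INR).
unfold Rdiv; ring.
Qed.

Lemma is_pseries_cos (y : R) :
  is_pseries (fun n => (-1) ^ n / INR (fact (2 * n)))%R (y ^ 2)%R (cos y).
Proof.
apply is_pseries_R, is_series_Reals; unfold cos.
destruct (exist_cos (Rsqr y)) as [l Hl]; unfold cos_in, cos_n in Hl.
now rewrite <- Rsqr_pow2.
Qed.

Lemma is_pseries_sin (y : R) : exists l, sin y = (y * l)%R /\
  is_pseries (fun n => (-1) ^ n / INR (fact (2 * n + 1)))%R (y ^ 2)%R l.
Proof.
unfold sin; destruct (exist_sin (Rsqr y)) as [l Hl]; unfold sin_in, sin_n in Hl.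
exists l; split; [reflexivity|].
apply is_pseries_R, is_series_Reals; now rewrite <- Rsqr_pow2.
Qed.

Lemma Ci_pow_even (n : nat) : Ci ^ (2 * n) = RtoC ((-1) ^ n).
Proof.
rewrite Cpow_mult_r.
replace (Ci ^ 2) with (RtoC (-1)) by (apply injective_projections; simpl; ring).
now rewrite RtoC_pow.
Qed.

Lemma Ci_pow_odd (n : nat) : Ci ^ (2 * n + 1) = RtoC ((-1) ^ n) * Ci.
Proof. rewrite Cpow_add_r, Ci_pow_even; simpl; ring. Qed.

Lemma is_pseries_zero (x : R) : is_pseries (fun _ : nat => 0%R) x 0%R.
Proof.
apply is_pseries_R, is_series_Reals; intros eps Heps; exists O; intros n _.
rewrite (sum_eq _ (fun _ => 0%R)) by (intros; ring).
rewrite sum_cte; rewrite Rmult_0_l, Rdist_eq; exact Heps.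
Qed.

(** Euler's formula: the even powers of i are real and give the cosine series, the odd ones are
    imaginary and give the sine series. *)
Lemma abs_sum_fexp_imag (y : R) : abs_sum (fexp (0%R, y)) (cos y, sin y).
Proof.
assert (Hn : forall n, fexp (0%R, y) n = Ci ^ n * RtoC (/ INR (fact n) * y ^ n)).
{ intros n; unfold fexp.
  replace (0%R, y) with (Ci * RtoC y) by (apply injective_projections; simpl; ring).
  rewrite Cpow_mult_l, RtoC_mult, RtoC_pow, RtoC_inv by apply INR_fact_neq_0.
  unfold Cdiv; ring. }
split; [|split]; [| |apply ex_series_fexp].
- apply (is_series_ext (fun n => Re (Ci ^ n) / INR (fact n) * y ^ n)%R).
  + intros n; rewrite Hn; simpl; unfold Rdiv, Re; ring.
  + simpl Re; apply (is_pseries_R (fun n => Re (Ci ^ n) / INR (fact n))%R).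
    (* [is_pseries_odd_even] expects the sum as an even part plus y times an odd part; the odd part
       is 0 here. *)
    replace (cos y) with (cos y + y * 0)%R by ring.
    apply is_pseries_odd_even.
    * eapply is_pseries_ext; [|apply is_pseries_cos].
      intros n; now rewrite Ci_pow_even.
    * eapply is_pseries_ext; [|apply is_pseries_zero].
      intros n; rewrite Ci_pow_odd; simpl; unfold Rdiv; ring.
- apply (is_series_ext (fun n => Im (Ci ^ n) / INR (fact n) * y ^ n)%R).
  + intros n; rewrite Hn; simpl; unfold Rdiv, Im; ring.
  + simpl Im; apply (is_pseries_R (fun n => Im (Ci ^ n) / INR (fact n))%R).
    destruct (is_pseries_sin y) as (l & -> & Hl).
    replace (y * l)%R with (0 + y * l)%R by ring.
    apply is_pseries_odd_even.
    * eapply is_pseries_ext; [|apply is_pseries_zero].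
      intros n; rewrite Ci_pow_even; simpl; unfold Rdiv; ring.
    * eapply is_pseries_ext; [|exact Hl].
      intros n; rewrite Ci_pow_odd; simpl; unfold Rdiv; ring.
Qed.

Lemma abs_sum_fexp_real (x : R) : abs_sum (fexp (RtoC x)) (RtoC (exp x)).
Proof.
assert (Hn : forall n, fexp (RtoC x) n = RtoC (/ INR (fact n) * x ^ n)).
{ intros n; unfold fexp.
  rewrite RtoC_mult, RtoC_pow, RtoC_inv by apply INR_fact_neq_0.
  unfold Cdiv; ring. }
split; [|split]; [| |apply ex_series_fexp].
- eapply is_series_ext; [|exact (proj1 (is_pseries_R _ _ _) (is_exp_Reals x))].
  intros n; now rewrite Hn.
- eapply is_series_ext; [|exact (proj1 (is_pseries_R _ _ _) (is_pseries_zero x))].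
  intros n; rewrite Hn; simpl; ring.
Qed.

Lemma abs_sum_fexp (t : C) : abs_sum (fexp t) (Cexp t).
Proof.
replace (fexp t) with (fmul (fexp (RtoC (Re t))) (fexp (0%R, Im t))).
- replace (Cexp t) with (RtoC (exp (Re t)) * (cos (Im t), sin (Im t))).
  + apply abs_sum_mul; [apply abs_sum_fexp_real | apply abs_sum_fexp_imag].
  + apply injective_projections; unfold Cexp; simpl; ring.
- rewrite fexp_add; f_equal; apply injective_projections; unfold Re, Im; simpl; ring.
Qed.

Lemma fev_E (t : C) : fev fE t (Cexp t).
Proof.
eapply abs_sum_ext; [|apply abs_sum_fexp].
intros n; unfold fE, fexp; rewrite Cpow_1_l; unfold Cdiv; ring.
Qed.

Lemma fev_U (t : C) : fev fU t (Cexp t - 1).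
Proof. apply fev_sub; [apply fev_E | apply fev_cst]. Qed.

Lemma Cexp_plus (z w : C) : Cexp (z + w) = Cexp z * Cexp w.
Proof.
unfold Cexp, Re, Im; simpl; rewrite exp_plus, cos_plus, sin_plus.
apply injective_projections; simpl; ring.
Qed.

Lemma Cexp_INR_mult (n : nat) (t : C) : Cexp (INR n * t) = Cexp t ^ n.
Proof.
induction n as [|n IH].
- apply injective_projections; simpl;
    rewrite !Rmult_0_l, Rplus_0_r, Rminus_0_r, exp_0, ?cos_0, ?sin_0; ring.
- rewrite S_INR, RtoC_plus, Cmult_plus_distr_r, Cmult_1_l, Cexp_plus, IH.
  simpl; ring.
Qed.

(** Balls of C are products of real balls, so convergence of the two components is enough. *)
Lemma fev_is_pseries (a : nat -> C) (t v : C) : fev a t v -> is_pseries a t v.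
Proof.
intros (H1 & H2 & _).
assert (Hs : forall N, sum_n (fun n => scal (pow_n t n) (a n)) N =
  (sum_n (fun n => Re (a n * t ^ n)) N, sum_n (fun n => Im (a n * t ^ n)) N)).
{ assert (Ht : forall n, scal (pow_n t n) (a n) = a n * t ^ n :> C).
  { intros n; transitivity (t ^ n * a n); [reflexivity|ring]. }
  induction N as [|N IH].
  - rewrite !sum_O, Ht; reflexivity.
  - rewrite !sum_Sn, IH, Ht; reflexivity. }
apply filterlim_locally; intros eps.
destruct (proj1 (filterlim_locally _ _) H1 eps) as [N1 HN1].
destruct (proj1 (filterlim_locally _ _) H2 eps) as [N2 HN2].
exists (max N1 N2); intros n Hn; rewrite Hs; split.
- apply HN1; lia.
- apply HN2; lia.
Qed.

End Evaluation.

(** * Growth of the Bernoulli and p-Bernoulli coefficients *)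

Lemma bernoulli_egf_sum (n : nat) : (1 <= n)%nat ->
  sum_f_R0 (fun k => bernoulli k / INR (fact k) * / INR (fact (S n - k))) n = 0.
Proof.
intros Hn.
rewrite (sum_eq _ (fun k => Binomial.C (S n) k * bernoulli k * / INR (fact (S n)))).
- now rewrite <- scal_sum, bernoulli_sum, Rmult_0_r.
- intros k Hk; unfold Binomial.C; field; repeat split; apply INR_fact_neq_0.
Qed.

Lemma inv_fact_le (n : nat) : / INR (fact (S n)) <= (/ 2) ^ n.
Proof.
induction n as [|n IH]; [simpl; lra|].
rewrite fact_simpl, mult_INR, Rinv_mult; simpl pow.
apply Rmult_le_compat; [| |apply Rinv_le_contravar; [lra|]|exact IH].
- left; apply Rinv_0_lt_compat, lt_0_INR; lia.
- left; apply Rinv_0_lt_compat, INR_fact_lt_0.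
- rewrite !S_INR; pose proof (pos_INR n); lra.
Qed.

(** The terms are 1/j! for 2 <= j <= m + 2, each at most 2^(1-j), so a geometric sum bounds them.
    These are the weights in the recurrence for B_n / n!. *)
Lemma sum_inv_fact_le (m : nat) :
  sum_f_R0 (fun k => / INR (fact (S (S m) - k))) m <= 1 - (/ 2) ^ S m.
Proof.
induction m as [|m IH]; [simpl; lra|].
rewrite sum_f_R0_first, Nat.sub_0_r.
change (fun k => / INR (fact (S (S (S m)) - S k)))
  with (fun k => / INR (fact (S (S m) - k))).
pose proof (inv_fact_le (S (S m))); simpl pow in *; lra.
Qed.

(** Up to sign, B_n / n! is a combination of the earlier quotients with positive weights of sum
    below 1, so the bound 1 propagates by strong induction. *)
Lemma bernoulli_egf_bound (n : nat) : Rabs (bernoulli n / INR (fact n)) <= 1.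
Proof.
induction n as [n IH] using lt_wf_ind; destruct n as [|m].
- rewrite bernoulli_0; simpl; rewrite Rdiv_1_r, Rabs_R1; lra.
- pose proof (bernoulli_egf_sum (S m)) as Hs.
  (* The last summand has weight 1/1!, so the recurrence can be solved for it. *)
  rewrite tech5 in Hs.
  replace (S (S m) - S m)%nat with 1%nat in Hs by lia.
  simpl (fact 1) in Hs; simpl (INR 1) in Hs.
  replace (bernoulli (S m) / INR (fact (S m))) with
    (- sum_f_R0 (fun k => bernoulli k / INR (fact k) * / INR (fact (S (S m) - k))) m)
    by (specialize (Hs ltac:(lia)); lra).
  rewrite Rabs_Ropp.
  eapply Rle_trans; [apply Rsum_abs|].
  eapply Rle_trans; [apply (sum_Rle _ (fun k => / INR (fact (S (S m) - k))))|].
  + intros k Hk.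
    assert (Hp : 0 < / INR (fact (S (S m) - k)))
      by apply Rinv_0_lt_compat, INR_fact_lt_0.
    rewrite Rabs_mult, (Rabs_pos_eq (/ _)) by lra.
    rewrite <- (Rmult_1_l (/ _)) at 2.
    apply Rmult_le_compat_r; [lra|apply IH; lia].
  + pose proof (sum_inv_fact_le m).
    assert (0 < (/ 2) ^ S m) by (apply pow_lt; lra); lra.
Qed.

Definition fB (B : nat -> nat -> R) (p : nat) : fps :=
  fun n => RtoC (B n p / INR (fact n)).

Lemma fderiv_fB (B : nat -> nat -> R) (p n : nat) :
  fderiv (fB B p) n = RtoC (B (S n) p / INR (fact n)).
Proof.
unfold fderiv, fB; rewrite <- RtoC_mult, fact_simpl, mult_INR.
f_equal; field; split; [apply INR_fact_neq_0|apply not_0_INR; lia].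
Qed.

Lemma pBernoulli_step (B : nat -> nat -> R) (p n : nat) : is_pBernoulli B ->
  INR (S p) * INR (S p) * B n (S p) =
  INR (S (S p)) * (INR p * B n p - B (S n) p).
Proof.
intros [_ HB]; rewrite (HB n p), !S_INR; pose proof (pos_INR p); field; lra.
Qed.

(** A geometric bound survives the recursion in p: differentiation costs a factor n + 1 <= 2^n,
    absorbed by doubling K. Hence every F_p converges absolutely near 0. *)
Lemma fB_bound (B : nat -> nat -> R) (p : nat) : is_pBernoulli B ->
  exists M K, 0 <= M /\ 1 <= K /\
    forall n, Rabs (B n p / INR (fact n)) <= M * K ^ n.
Proof.
intros HB; induction p as [|p (M & K & HM & HK & H)].
- exists 1, 1; repeat split; try lra; intros n.
  rewrite pow1, (proj1 HB), Rmult_1_l; apply bernoulli_egf_bound.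
- set (c := INR (S (S p)) / (INR (S p) * INR (S p))).
  assert (Hp : 0 < INR (S p)) by (apply lt_0_INR; lia).
  assert (Hc : 0 <= c).
  { apply Rmult_le_pos; [apply pos_INR|].
    left; apply Rinv_0_lt_compat; nra. }
  pose proof (pos_INR p) as Hp0.
  (* The summand p M bounds the undifferentiated term, and M K bounds the derivative, whose
     coefficients are one index further. *)
  exists (c * (INR p * M + M * K)), (2 * K); split; [|split].
  + apply Rmult_le_pos; [exact Hc|nra].
  + lra.
  + intros n.
    assert (HKn : 0 < K ^ n) by (apply pow_lt; lra).
    assert (H2 : INR (S n) <= 2 ^ n).
    { clear; induction n as [|n IH]; [simpl; lra|].
      rewrite S_INR; simpl pow; pose proof (pow_R1_Rle 2 n); lra. }
    assert (H1 : 1 <= 2 ^ n) by (apply pow_R1_Rle; lra).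
    replace (B n (S p) / INR (fact n)) with
      (c * (INR p * (B n p / INR (fact n))
            - INR (S n) * (B (S n) p / INR (fact (S n))))).
    * rewrite Rabs_mult, (Rabs_pos_eq c) by exact Hc.
      rewrite !Rmult_assoc; apply Rmult_le_compat_l; [exact Hc|].
      eapply Rle_trans; [apply Rabs_triang|].
      rewrite Rabs_Ropp, !Rabs_mult, !(Rabs_pos_eq (INR _)) by apply pos_INR.
      rewrite Rpow_mult_distr, Rmult_plus_distr_r; apply Rplus_le_compat.
      -- rewrite (Rmult_assoc (INR p)); apply Rmult_le_compat_l; [exact Hp0|].
         eapply Rle_trans; [apply H|]; apply Rmult_le_compat_l; [exact HM|nra].
      -- replace (M * K * (2 ^ n * K ^ n)) with (2 ^ n * (M * K ^ S n))
           by (simpl; ring).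
         apply Rmult_le_compat; [apply pos_INR|apply Rabs_pos|exact H2|apply H].
    * pose proof (pBernoulli_step B p n HB) as E.
      apply (Rmult_eq_reg_l (INR (S p) * INR (S p))); [|nra].
      transitivity (INR (S p) * INR (S p) * B n (S p) / INR (fact n));
        [rewrite E|unfold Rdiv; ring].
      unfold c; rewrite fact_simpl, mult_INR; field.
      repeat split; try apply INR_fact_neq_0; try lra; apply not_0_INR; lia.
Qed.

(** * The closed form, first for formal series and then for values *)

Section ClosedForm.
Local Open Scope C_scope.

Lemma fmul_bernoulli : fmul (fun n => RtoC (bernoulli n / INR (fact n))) fU = fX.
Proof.
assert (HU : forall n, fU (S n) = RtoC (/ INR (fact (S n)))).
{ intros n; unfold fU, fE, fsub, fadd, fopp, fexp; rewrite Cpow_1_l.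
  rewrite RtoC_inv by apply INR_fact_neq_0.
  unfold fcst, Cdiv; ring. }
assert (HU0 : fU O = 0).
{ unfold fU, fE, fsub, fadd, fopp, fexp; simpl; field. }
apply functional_extensionality; intros [|n].
- rewrite fmul_O, HU0; simpl; ring.
- rewrite fmul_S_last, HU0.
  replace (fmul (fun n0 => RtoC (bernoulli n0 / INR (fact n0))) (fshift fU) n) with
    (RtoC (sum_f_R0
      (fun k => bernoulli k / INR (fact k) * / INR (fact (S n - k)))%R n)).
  + destruct n as [|n].
    (* The coefficient of X is B_0 = 1; all later ones vanish by the Bernoulli recurrence. *)
    * replace (sum_f_R0 _ 0) with 1%R
        by (simpl; rewrite bernoulli_0; field).
      simpl; ring.
    * rewrite bernoulli_egf_sum by lia; simpl; ring.
  + rewrite fmul_sum; unfold fshift; apply injective_projections; cbn [fst snd RtoC].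
    * apply sum_eq; intros k Hk; rewrite HU, Nat.sub_succ_l by exact Hk.
      now rewrite <- RtoC_mult.
    * rewrite (sum_eq _ (fun _ => 0%R)); [rewrite sum_cte; ring|].
      intros k Hk; now rewrite HU, <- RtoC_mult.
Qed.

Lemma harmonic_0 : harmonic 0 = 0%R.
Proof. unfold harmonic; now rewrite sum_n_m_zero by lia. Qed.

Lemma fB_mul_Upow (B : nat -> nat -> R) (p : nat) : is_pBernoulli B ->
  fmul (fB B p) (fpow fU (S p)) = fnum p.
Proof.
intros HB; induction p as [|p IH].
- unfold fnum; rewrite harmonic_0; simpl fpow; simpl fS; simpl INR.
  replace (fB B 0) with (fun n => RtoC (bernoulli n / INR (fact n)))
    by (apply functional_extensionality; intros n; unfold fB; now rewrite (proj1 HB)).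
  transitivity fX; [rewrite <- fmul_bernoulli|]; ring.
- apply (fps_step p (fB B p)); [|exact IH].
  rewrite !fmul_cst; apply functional_extensionality; intros n.
  unfold fsub, fadd, fopp; rewrite fderiv_fB; unfold fB.
  rewrite <- !RtoC_mult, <- RtoC_opp, <- RtoC_plus, <- RtoC_mult; f_equal.
  unfold Rdiv; rewrite <- Rmult_assoc, pBernoulli_step by exact HB; ring.
Qed.

(* Unlike [Binomial.C], which is 1/(n+1) at k = n+1, [bin n k] vanishes for k > n. *)
Fixpoint bin (n k : nat) : nat :=
  match n, k with
  | _, O => 1
  | O, S _ => 0
  | S m, S j => bin m j + bin m (S j)
  end%nat.

Lemma bin_0_r (n : nat) : bin n 0 = 1%nat.
Proof. now destruct n. Qed.

Lemma bin_gt (n k : nat) : (n < k)%nat -> bin n k = 0%nat.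
Proof.
revert k; induction n as [|n IH]; intros [|k] Hk; try lia; [reflexivity|].
simpl; rewrite !IH; lia.
Qed.

Lemma bin_diag (n : nat) : bin n n = 1%nat.
Proof. induction n as [|n IH]; [reflexivity|]; simpl; rewrite IH, bin_gt; lia. Qed.

Lemma bin_absorb (n k : nat) : (S k * bin (S n) (S k) = S n * bin n k)%nat.
Proof.
revert k; induction n as [|n IH]; intros k.
- destruct k; simpl; lia.
- change (bin (S (S n)) (S k)) with (bin (S n) k + bin (S n) (S k))%nat.
  destruct k as [|k].
  + pose proof (IH O) as H0; rewrite bin_0_r in H0 |- *; lia.
  + pose proof (IH k) as H0; pose proof (IH (S k)) as H1.
    change (bin (S n) (S k)) with (bin n k + bin n (S k))%nat in H0 |- *; nia.
Qed.

Lemma bin_binomial (n k : nat) : (k <= n)%nat -> Binomial.C n k = INR (bin n k).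
Proof.
revert k; induction n as [|n IH]; intros k Hk.
- replace k with O by lia; unfold Binomial.C; simpl; field.
- destruct k as [|k].
  + unfold Binomial.C; rewrite Nat.sub_0_r; simpl (fact 0); rewrite bin_0_r.
    simpl (INR 1); field; apply INR_fact_neq_0.
  + destruct (Nat.eq_dec k n) as [->|Hne].
    * rewrite bin_diag; unfold Binomial.C; rewrite Nat.sub_diag.
      simpl (fact 0); simpl (INR 1); field; apply INR_fact_neq_0.
    * rewrite <- pascal, !IH by lia; simpl; now rewrite plus_INR.
Qed.

(** * Binomial sums weighted by harmonic numbers *)

Lemma sum_n_first (f : nat -> C) (N : nat) :
  sum_n f (S N) = f O + sum_n (fun k => f (S k)) N.
Proof.
induction N as [|N IH]; [now rewrite sum_Sn, !sum_O|].
rewrite sum_Sn, IH, sum_Sn.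
change plus with Cplus; simpl; ring.
Qed.

(** The cut-off N is kept apart from p: as [bin p k] vanishes for k > p, every N >= p gives the same
    sum, and Pascal's rule needs no boundary cases. *)
Definition binsum (p N : nat) (x : C) : C :=
  sum_n (fun k => INR (bin p k) * x ^ k) N.

Definition hbinsum (p N : nat) (x : C) : C :=
  sum_n (fun k => INR (bin p k) * (harmonic k * x ^ k)) N.

Lemma sum_n_C_zero (f : nat -> C) (N : nat) : (forall k, f k = 0) -> sum_n f N = RtoC 0.
Proof.
intros Hf; induction N as [|N IH]; [now rewrite sum_O|].
rewrite sum_Sn, IH, Hf; change plus with Cplus; simpl; ring.
Qed.

Lemma sum_n_C_plus (f g : nat -> C) (N : nat) :
  sum_n (fun k => f k + g k) N = sum_n f N + sum_n g N.
Proof. exact (sum_n_plus f g N). Qed.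

Lemma sum_n_C_mult (c : C) (f : nat -> C) (N : nat) :
  sum_n (fun k => c * f k) N = c * sum_n f N.
Proof. exact (sum_n_mult_l c f N). Qed.

Lemma binsum_pow (p N : nat) (x : C) : (p <= N)%nat -> binsum p N x = (1 + x) ^ p.
Proof.
revert N; induction p as [|p IH]; intros N HN; unfold binsum in *.
- destruct N as [|N]; [rewrite sum_O; simpl; ring|].
  rewrite sum_n_first, sum_n_C_zero; [simpl; ring|].
  intros k; simpl; ring.
- destruct N as [|N]; [lia|].
  pose proof (IH (S N) ltac:(lia)) as H; rewrite sum_n_first, bin_0_r in H.
  rewrite sum_n_first, bin_0_r.
  rewrite (sum_n_ext _ (fun k => x * (INR (bin p k) * x ^ k)
                                 + INR (bin p (S k)) * x ^ S k)).
  + rewrite sum_n_C_plus, sum_n_C_mult, IH by lia.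
    transitivity (x * (1 + x) ^ p + (1 + x) ^ p); [|simpl; ring].
    rewrite <- H; ring.
  + intros k; simpl bin; rewrite plus_INR, RtoC_plus; simpl; ring.
Qed.

(** Pascal's rule and H_(k+1) = H_k + 1/(k+1) give (1 + x) times the old sum, plus terms C(p,k)
    x^(k+1) / (k+1). By absorption these are C(p+1,k+1) x^(k+1) / (p+1), and the binomial theorem
    sums them. *)
Lemma hbinsum_S (p N : nat) (x : C) : (p <= N)%nat ->
  hbinsum (S p) (S N) x =
  (1 + x) * hbinsum p N x + / INR (S p) * ((1 + x) ^ S p - 1).
Proof.
intros HN.
assert (HE : hbinsum p (S N) x = hbinsum p N x).
{ unfold hbinsum; rewrite sum_Sn, bin_gt by lia.
  change plus with Cplus; simpl; ring. }
rewrite <- (binsum_pow (S p) (S N) x) by lia.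
transitivity (hbinsum p (S N) x + x * hbinsum p N x
  + / INR (S p) * (binsum (S p) (S N) x - 1)); [|rewrite HE; ring].
unfold hbinsum, binsum; rewrite !sum_n_first, !bin_0_r, harmonic_0.
rewrite <- (sum_n_C_mult x).
transitivity (sum_n (fun k => INR (bin p (S k)) * (harmonic (S k) * x ^ S k)) N
  + sum_n (fun k => x * (INR (bin p k) * (harmonic k * x ^ k))) N
  + / INR (S p) * sum_n (fun k => INR (bin (S p) (S k)) * x ^ S k) N);
  [|simpl; ring].
rewrite <- sum_n_C_mult, <- !sum_n_C_plus.
transitivity (sum_n (fun k => INR (bin (S p) (S k)) * (harmonic (S k) * x ^ S k)) N);
  [ring|].
apply sum_n_ext; intros k.
assert (Hk : / INR (S p) * INR (bin (S p) (S k)) = INR (bin p k) * / INR (S k)).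
{ pose proof (f_equal (fun n => RtoC (INR n)) (bin_absorb p k)) as Ha.
  cbv beta in Ha; rewrite !mult_INR, !RtoC_mult in Ha.
  transitivity (/ INR (S p) * / INR (S k) * (INR (S k) * INR (bin (S p) (S k))));
    [field; auto using RtoC_INR_S_neq_0|].
  rewrite Ha; field; auto using RtoC_INR_S_neq_0. }
rewrite (Cmult_assoc (/ _)), Hk; simpl bin.
rewrite plus_INR, harmonic_S, !RtoC_plus, RtoC_inv by (apply not_0_INR; lia).
(* The equality lives in a carrier that is merely convertible to [C]; it is restated in [C] for
   [ring]. *)
match goal with |- ?a = ?b => change (@eq C a b) end.
change (x ^ S k) with (x * x ^ k).
ring.
Qed.

(** For u = e^t - 1 and x = 1/u one has 1 + x = e^t / u, so u^(p+1) times the recursion [hbinsum_S]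
    is the recursion defining [fS]. *)
Lemma fev_S (p N : nat) (t : C) : Cexp t - 1 <> 0 -> (p <= N)%nat ->
  fev (fS p) t ((Cexp t - 1) ^ p * hbinsum p N (/ (Cexp t - 1))).
Proof.
intros Hu; revert N; induction p as [|p IH]; intros N HN.
- replace (hbinsum 0 N (/ (Cexp t - 1))) with (RtoC 0).
  + rewrite Cmult_0_r; apply fev_cst.
  + symmetry; apply sum_n_C_zero; intros [|k]; [rewrite harmonic_0|]; simpl; ring.
- destruct N as [|N]; [lia|]; rewrite hbinsum_S by lia.
  pose proof (fev_add _ _ _ _ _
    (fev_mul _ _ _ _ _ (fev_E t) (IH N ltac:(lia)))
    (fev_mul _ _ _ _ _ (fev_cst (/ INR (S p)) t)
      (fev_sub _ _ _ _ _ (fev_pow _ _ _ (S p) (fev_E t))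
                         (fev_pow _ _ _ (S p) (fev_U t))))) as H.
  match goal with |- fev _ _ ?w => match type of H with fev _ _ ?v =>
    replace w with v; [exact H|] end end.
  replace (1 + / (Cexp t - 1)) with (Cexp t * / (Cexp t - 1)) by (field; exact Hu).
  rewrite Cpow_mult_l, Cpow_inv by exact Hu.
  assert (Hp : (Cexp t - 1) ^ p <> 0) by now apply Cpow_nz.
  rewrite !Cpow_S.
field; auto using RtoC_INR_S_neq_0.
Qed.

Lemma ex_series_fB (B : nat -> nat -> R) (p : nat) (t : C) (M K : R) :
  (0 <= K)%R -> (forall n, Rabs (B n p / INR (fact n)) <= M * K ^ n)%R ->
  (K * Cmod t < 1)%R -> ex_series (fun n => Cmod (fB B p n * t ^ n)).
Proof.
intros HK H Ht.
refine (ex_series_le _ (fun n => M * (K * Cmod t) ^ n)%R _ _).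
- intros n; change norm with Rabs; simpl; rewrite Rabs_pos_eq by apply Cmod_ge_0.
  unfold fB; rewrite Cmod_mult, Cmod_R, Cmod_pow, Rpow_mult_distr, <- Rmult_assoc.
  apply Rmult_le_compat_r; [apply pow_le, Cmod_ge_0|apply H].
- apply (ex_series_scal_l M (fun n => (K * Cmod t) ^ n)%R), ex_series_geom.
  rewrite Rabs_pos_eq; [exact Ht|].
  apply Rmult_le_pos; [exact HK|apply Cmod_ge_0].
Qed.

(** If e^t - 1 were 0, evaluating F_0 U = T at t would give t = 0. The bound on t makes F_0 converge
    there. *)
Lemma Cexp_neq_1 (t : C) : t <> 0 -> (Cmod t < 1)%R -> Cexp t - 1 <> 0.
Proof.
intros Ht Ht1 Hu.
destruct (abs_sum_exists
  (fun n => RtoC (bernoulli n / INR (fact n)) * t ^ n)) as [v Hv].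
- apply (ex_series_fB (fun n _ => bernoulli n) O t 1 1); [lra| |lra].
  intros n; rewrite pow1, Rmult_1_l; apply bernoulli_egf_bound.
- apply Ht, (fev_unique fX t); [apply fev_X|].
  rewrite <- fmul_bernoulli; replace (RtoC 0) with (v * (Cexp t - 1)).
  + apply fev_mul; [exact Hv|apply fev_U].
  + rewrite Hu; ring.
Qed.

Lemma fev_fB (B : nat -> nat -> R) (p : nat) (t : C) (M K : R) :
  is_pBernoulli B -> (1 <= K)%R ->
  (forall n, Rabs (B n p / INR (fact n)) <= M * K ^ n)%R ->
  t <> 0 -> (K * Cmod t < 1)%R ->
  fev (fB B p) t
    (INR (S p) * ((t - harmonic p) * Cexp t ^ p / (Cexp t - 1) ^ S p
                  + hbinsum p p (/ (Cexp t - 1)) / (Cexp t - 1))).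
Proof.
intros HB HK H Ht HKt.
assert (Hu : Cexp t - 1 <> 0).
{ apply Cexp_neq_1; [exact Ht|].
  pose proof (Cmod_ge_0 t); nra. }
destruct (abs_sum_exists _ (ex_series_fB B p t M K ltac:(lra) H HKt)) as [v Hv].
match goal with |- fev _ _ ?w => replace w with v; [exact Hv|] end.
(* Both sides are values at t of one series, F_p U^(p+1) = [fnum p]; dividing by the nonzero u^(p+1)
   then determines v. *)
assert (E : v * (Cexp t - 1) ^ S p = INR (S p) * ((t - harmonic p) * Cexp t ^ p
  + (Cexp t - 1) ^ p * hbinsum p p (/ (Cexp t - 1)))).
{ apply (fev_unique (fnum p) t).
  - rewrite <- (fB_mul_Upow B p HB).
    apply fev_mul; [exact Hv|apply fev_pow, fev_U].
  - apply fev_mul; [apply fev_cst|]; apply fev_add; [|now apply fev_S].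
    apply fev_mul; [apply fev_sub; [apply fev_X|apply fev_cst]|apply fev_pow, fev_E]. }
assert (Hp : (Cexp t - 1) ^ p <> 0) by now apply Cpow_nz.
assert (Hp' : (Cexp t - 1) ^ S p <> 0) by now apply Cpow_nz.
replace v with (v * (Cexp t - 1) ^ S p / (Cexp t - 1) ^ S p) by (field; exact Hp').
rewrite E, Cpow_S; field; auto.
Qed.

End ClosedForm.

Theorem theorem1 (B : nat -> nat -> R) (HB : is_pBernoulli B) (p : nat) :
  locally' (RtoC 0) (fun t : C =>
    is_pseries (fun n : nat => RtoC (B n p / INR (fact n))) t
      (((INR p + 1) * (t - harmonic p) * Cexp (INR p * t)
          / (Cexp t - 1) ^ (p + 1)
        + (INR p + 1) *
          sum_n_m (fun k : nat =>
            Binomial.C p k * (harmonic k / (Cexp t - 1) ^ (k + 1))) 1 p)%C)).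
Proof.
destruct (fB_bound B p HB) as (M & K & HM & HK & H).
(* Balls of C bound each component, and |t| <= sqrt 2 max(|Re t|, |Im t|) with sqrt 2 <= 2; the
   radius 1/(2K) therefore ensures K |t| < 1. *)
assert (He : 0 < / (2 * K)) by (apply Rinv_0_lt_compat; lra).
exists (mkposreal _ He); intros t [Ht1 Ht2] Ht; simpl in Ht1, Ht2.
assert (HKt : K * Cmod t < 1).
{ unfold ball, AbsRing_ball in Ht1, Ht2; simpl in Ht1, Ht2.
  unfold AbsRing_ball, abs, minus, plus, opp in Ht1, Ht2; simpl in Ht1, Ht2.
  rewrite Ropp_0, Rplus_0_r in Ht1, Ht2.
  assert (Cmod t < / K).
  { eapply Rle_lt_trans; [apply Cmod_2Rmax|].
    apply Rle_lt_trans with (2 * Rmax (Rabs (fst t)) (Rabs (snd t))).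
    - apply Rmult_le_compat_r.
      + eapply Rle_trans; [apply Rabs_pos|apply Rmax_l].
      + apply Rlt_le, Rlt_le_trans with (sqrt 4);
          [apply sqrt_lt_1; lra|replace 4 with (2 * 2) by ring; rewrite sqrt_square; lra].
    - replace (/ K) with (2 * / (2 * K)) by (field; lra).
      apply Rmult_lt_compat_l; [lra|now apply Rmax_lub_lt]. }
  rewrite <- (Rinv_r K) by lra; apply Rmult_lt_compat_l; lra. }
pose proof (fev_fB B p t M K HB HK H Ht HKt) as Hev.
assert (Hu : (Cexp t - 1 <> 0)%C).
{ apply Cexp_neq_1; [exact Ht|pose proof (Cmod_ge_0 t); nra]. }
apply fev_is_pseries in Hev.
match goal with |- is_pseries _ _ ?w => match type of Hev with is_pseries _ _ ?v =>
  replace w with v; [exact Hev|] end end.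
rewrite S_INR, RtoC_plus, Cexp_INR_mult, Nat.add_1_r, Cmult_plus_distr_l.
f_equal; [unfold Cdiv; ring|f_equal].
transitivity (/ (Cexp t - 1) * hbinsum p p (/ (Cexp t - 1)))%C; [unfold Cdiv; ring|].
unfold hbinsum; rewrite <- sum_n_C_mult.
(* The term k = 0 splits off and vanishes because H_0 = 0, so the sum starts at 1. *)
unfold sum_n; rewrite sum_Sn_m by lia; rewrite harmonic_0.
transitivity (sum_n_m (fun k => / (Cexp t - 1) * (INR (bin p k)
  * (harmonic k * (/ (Cexp t - 1)) ^ k)))%C 1 p).
- change plus with Cplus; simpl; ring.
- apply sum_n_m_ext_loc; intros k Hk.
  rewrite bin_binomial by lia; rewrite Cpow_inv by exact Hu.
  assert (Hk' : ((Cexp t - 1) ^ k <> 0)%C) by now apply Cpow_nz.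
  rewrite Nat.add_1_r, Cpow_S.
  match goal with |- ?a = ?b => change (@eq C a b) end; field; auto.
Qed.
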